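(* Almost surely, $$\lim_n\ \sup_{t\in[0,1]}\left|\frac1n\,\Xi_{n,\lfloor nt\rfloor}+\mathcal J(1-t)\right|=0.$$
   Context: Let $(b_{i,j})_{i,j\ge1}$ be a doubly infinite array of i.i.d. $\mathcal N(0,1)$ random variables on one probability space. For $1\le r\le n$ let $B_{n,r}=(b_{i,j})_{1\le i\le n,\,1\le j\le r}$ and $\Xi_{n,r}=\log\det\big(\frac1nB_{n,r}'B_{n,r}\big)$, where $'$ denotes transpose, with $\Xi_{n,0}=0$. The function $\mathcal J$ is $\mathcal J(u)=u\log u-u+1$ for $u>0$, $\mathcal J(0)=1$, $\mathcal J(u)=+\infty$ for $u<0$. *)

(* Defs.v *)
From HB Require Import structures.
From mathcomp Require Import all_boot all_order all_algebra finmap.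
From mathcomp Require Import all_classical all_reals all_analysis.

Set Implicit Arguments.
Unset Strict Implicit.
Unset Printing Implicit Defensive.

Import Order.TTheory GRing.Theory Num.Theory.
Import numFieldNormedType.Exports.

Local Open Scope classical_set_scope.
Local Open Scope ring_scope.

Definition mutually_independent (d d' : measure_display)
    (T : measurableType d) (T' : measurableType d') (R : realType)
    (P : probability T R) (I : choiceType) (X : I -> {RV P >-> T'}) : Prop :=
  forall (J : {fset I}) (A : I -> set T'),
    (forall i, i \in J -> measurable (A i)) ->
    P (\bigcap_(i in [set` J]) (X i @^-1` A i)) =
    (\prod_(i <- J) P (X i @^-1` A i))%E.

(* Equality is required on measurable sets only: off the sigma-algebra the
   values of the two set functions carry no meaning. *)
Definition standard_normal (d : measure_display) (T : measurableType d)
    (R : realType) (P : probability T R) (X : {RV P >-> R}) : Prop :=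
  forall A : set R, measurable A -> distribution P X A = normal_prob 0 1 A.

Section GaussianGram.
Context {R : realType}.

(* Rows and columns are numbered from 0: b i j is b_{i+1,j+1}. *)
Definition data_mx (b : nat -> nat -> R) (n r : nat) : 'M[R]_(n, r) :=
  \matrix_(i < n, j < r) b i j.

(* lne 0 = -oo, so a singular Gram matrix has log-determinant -oo. *)
Definition logdet_gram (b : nat -> nat -> R) (n r : nat) : \bar R :=
  lne (\det (n%:R^-1 *: ((data_mx b n r)^T *m data_mx b n r)))%:E.

Lemma logdet_gram0 (b : nat -> nat -> R) (n : nat) :
  logdet_gram b n 0 = 0%E.
Proof. by rewrite /logdet_gram det_mx00 lne1. Qed.

Definition rate_J (u : R) : \bar R :=
  if 0 < u then (u * ln u - u + 1)%:E
  else if u == 0 then 1%E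
  else +oo%E.

End GaussianGram.

(* Main.v *)
From HB Require Import structures.
Require Import Defs.
From mathcomp Require Import all_boot all_order all_algebra finmap.
From mathcomp Require Import all_classical all_reals all_analysis.
From mathcomp Require Import measurable_realfun.
From mathcomp Require Import ring lra.

(** Write G(n,r) for the determinant of B_{n,r}' B_{n,r} and Y(n,r) for the
    squared distance from column r (columns are numbered from 0) to the span of
    columns 0, ..., r-1.  Then G(n,r+1) = G(n,r) Y(n,r), and Y(n,r) behaves like
    its mean m = n - r; so log G(n,r) is close to the sum over k < r of
    log (n-k), which the elementary bounds on log n! turn into
    r log n - n J(1 - r/n).

    The concentration of Y(n,r) is a Chernoff bound.  For a matrix M and a
    weight phi depending only on the earlier columns, with M positive definite,
    and for a standard Gaussian vector g independent of them,
      E[phi exp(g'(1 - M)g/2)] = E[phi (det M)^(-1/2)].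
    This is [expectation_gaussian_qform]; it is proved by integrating out the
    coordinates of g one at a time, each step replacing M by a Schur complement.
    If Q is the orthogonal projection onto the span of the earlier columns and
    M = Q + e^s (1 - Q), then g'(1 - M)g = (1 - e^s) Y(n,r) and
    det M = e^(s(n-r)); the rotation invariance of the Gaussian law is never
    needed.  The result, [deviation_set_le], is
      P(Y <= m e^(-t)) <= exp(-m (t - 1 + e^(-t)) / 2),
      P(Y >= m e^t)    <= exp(-m (e^t - 1 - t) / 2),
    on the event that G(n,r) is nonzero.

    Given eps > 0, column r is allowed a logarithmic error eps if m is at least
    a constant, depending on eps, times log n, and 1 + 6 log n otherwise.  With
    this tolerance each column fails with probability at most 2/n^3
    ([atypical_column_le]), so the n-th array fails with probability at most
    2/n^2, and by Borel-Cantelli the array is almost surely typical for all large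
    n ([ae_eventually_typical]).
    Only O(log n) columns have the large tolerance, so on a typical array the
    errors add up to at most eps n + O((1 + log n)^2), uniformly in r
    ([typical_logdet_close]).  Typical arrays also have nonzero Gram
    determinants, by induction on r, so no separate argument is needed for
    almost sure nonsingularity. *)

Set Implicit Arguments.
Unset Strict Implicit.
Unset Printing Implicit Defensive.

Import Order.TTheory GRing.Theory Num.Theory.
Import numFieldNormedType.Exports.

Local Open Scope classical_set_scope.
Local Open Scope ring_scope.

(** * Quadratic forms, Schur complements and Gram determinants *)

Section QuadraticForms.
Context {R : realFieldType}.

(** The quadratic form u' M u. *)
Definition qform n (M : 'M[R]_n) (u : 'cV[R]_n) : R := (u^T *m M *m u) 0 0.

(** Symmetric positive definite matrices. *)
Definition posdef n (M : 'M[R]_n) : Prop :=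
  M^T = M /\ forall u : 'cV[R]_n, u != 0 -> 0 < qform M u.

Lemma qformE n (M : 'M[R]_n) u :
  qform M u = \sum_i \sum_j u i 0 * M i j * u j 0.
Proof.
rewrite /qform mxE exchange_big; apply: eq_bigr => j _ /=.
rewrite mxE mulr_suml; apply: eq_bigr => i _.
by rewrite !mxE.
Qed.

Lemma qformD n (M N : 'M[R]_n) u : qform (M + N) u = qform M u + qform N u.
Proof. by rewrite /qform mulmxDr mulmxDl mxE. Qed.

Lemma qformN n (M : 'M[R]_n) u : qform (- M) u = - qform M u.
Proof. by rewrite /qform mulmxN mulNmx mxE. Qed.

Lemma qformZ n a (M : 'M[R]_n) u : qform (a *: M) u = a * qform M u.
Proof. by rewrite /qform -scalemxAr -scalemxAl mxE. Qed.

Lemma qform_gram m n (C : 'M[R]_(m, n)) u :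
  qform (C^T *m C) u = \sum_i (C *m u) i 0 ^+ 2.
Proof.
rewrite /qform mulmxA -mulmxA -trmx_mul mxE; apply: eq_bigr => i _.
by rewrite mxE expr2.
Qed.

Lemma qform_gram_ge0 m n (C : 'M[R]_(m, n)) u : 0 <= qform (C^T *m C) u.
Proof. by rewrite qform_gram; apply: sumr_ge0 => i _; exact: sqr_ge0. Qed.

Lemma qform_gram_eq0 m n (C : 'M[R]_(m, n)) u :
  qform (C^T *m C) u = 0 -> C *m u = 0.
Proof.
move=> /eqP; rewrite qform_gram psumr_eq0; last by move=> i _; exact: sqr_ge0.
move=> /allP H; apply/matrixP => i j; rewrite ord1 [RHS]mxE; apply/eqP.
by have := H i (mem_index_enum i); rewrite sqrf_eq0.
Qed.

Lemma qform_block k (a x : R) (v u : 'cV[R]_k) (M : 'M[R]_k) :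
  qform (block_mx a%:M v^T v M) (col_mx x%:M u) =
  a * x ^+ 2 + (v^T *m u) 0 0 * x *+ 2 + qform M u.
Proof.
rewrite /qform tr_col_mx mul_row_block mul_row_col tr_scalar_mx.
rewrite !mulmxDl !mul_scalar_mx -!scalemxAl !mul_mx_scalar.
have -> : u^T *m v = v^T *m u.
  by apply/matrixP => i j; rewrite !ord1 !mxE; apply: eq_bigr => t _; rewrite !mxE mulrC.
move: (v^T *m u) (u^T *m M *m u) => b q.
rewrite !mxE eqxx mulr1n; ring.
Qed.

Lemma posdef_block k (M : 'M[R]_(1 + k)) :
  posdef M -> M = block_mx (M 0 0)%:M (dlsubmx M)^T (dlsubmx M) (drsubmx M).
Proof.
move=> [sM _]; rewrite -[LHS]submxK; congr (block_mx _ _ _ _).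
  by apply/matrixP => i j; rewrite !ord1 !mxE eqxx mulr1n; congr (M _ _); apply/val_inj.
by rewrite -[in RHS]sM trmx_dlsub trmxK.
Qed.

Lemma qform_posdef_block k (M : 'M[R]_(1 + k)) x u : posdef M ->
  qform M (col_mx x%:M u) =
  M 0 0 * x ^+ 2 + ((dlsubmx M)^T *m u) 0 0 * x *+ 2 + qform (drsubmx M) u.
Proof. by move=> pM; rewrite [X in qform X _](posdef_block pM) qform_block. Qed.

Lemma qform_1_posdef_block k (M : 'M[R]_(1 + k)) x u : posdef M ->
  qform (1%:M - M) (col_mx x%:M u) =
  (1 - M 0 0) * x ^+ 2 - 2 * ((dlsubmx M)^T *m u) 0 0 * x +
  qform (1%:M - drsubmx M) u.
Proof.
move=> pM; rewrite !qformD !qformN (qform_posdef_block _ _ pM).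
have -> : 1%:M = block_mx 1%:M (0 : 'cV[R]_k)^T 0 1%:M :> 'M[R]_(1 + k).
  by rewrite trmx0 -scalar_mx_block.
rewrite qform_block trmx0 mul0mx [(0 : 'M[R]_(1, 1)) 0 0]mxE.
move: (_ 0 0) (_ 0 0) (qform _ _) (qform _ _) => a c p q; ring.
Qed.

Lemma posdef_corner_gt0 k (M : 'M[R]_(1 + k)) : posdef M -> 0 < M 0 0.
Proof.
move=> pM; have [_ /(_ (col_mx 1%:M 0))] := pM.
rewrite (qform_posdef_block _ _ pM) mulmx0 mxE expr1n mulr1 mul0r mul0rn.
rewrite /qform mulmx0 mxE !addr0; apply.
apply/eqP => /matrixP /(_ (lshift k 0) 0); rewrite col_mxEu !mxE eqxx => /eqP.
by rewrite oner_eq0.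
Qed.

(** The Schur complement of the top left entry, for a symmetric matrix: the
    row block is read off as the transpose of the column block. *)
Definition schur k (M : 'M[R]_(1 + k)) : 'M[R]_k :=
  drsubmx M - (M 0 0)^-1 *: (dlsubmx M *m (dlsubmx M)^T).

Lemma qform_schur k (M : 'M[R]_(1 + k)) u :
  qform (schur M) u =
  qform (drsubmx M) u - (M 0 0)^-1 * (((dlsubmx M)^T *m u) 0 0) ^+ 2.
Proof.
rewrite /schur qformD qformN qformZ; congr (_ - _ * _).
have := qform_gram (dlsubmx M)^T u; rewrite trmxK => ->.
by rewrite big_ord1.
Qed.

Lemma posdef_schur k (M : 'M[R]_(1 + k)) : posdef M -> posdef (schur M).
Proof.
move=> pM; have a0 := posdef_corner_gt0 pM;
have [sM Mpos] := pM; split.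
  rewrite /schur linearB linearZ /= trmx_mul trmxK; congr (_ - _).
  by rewrite trmx_drsub sM.
move=> u u0; set c := ((dlsubmx M)^T *m u) 0 0.
have := Mpos (col_mx (- (M 0 0)^-1 * c)%:M u).
rewrite (qform_posdef_block _ _ pM) -/c qform_schur -/c => H.
apply: lt_le_trans (H _) _.
  by apply/eqP => /eqP; rewrite col_mx_eq0 (negbTE u0) andbF.
rewrite le_eqVlt; apply/orP; left; apply/eqP; field.
by rewrite gt_eqF.
Qed.

Lemma det_block_schur m n (A : 'M[R]_m) (B : 'M[R]_(m, n)) (C : 'M[R]_(n, m))
    (D : 'M[R]_n) : A \in unitmx ->
  \det (block_mx A B C D) = \det A * \det (D - C *m invmx A *m B).
Proof.
move=> uA.
have -> : block_mx A B C D = block_mx A 0 C 1%:M *m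
    block_mx 1%:M (invmx A *m B) 0 (D - C *m invmx A *m B).
  rewrite mulmx_block ?(mulmx1, mulmx0, mul0mx, mul1mx, addr0) !mulmxA.
  by rewrite mulmxV// mul1mx addrC subrK.
by rewrite det_mulmx det_lblock det_ublock !det1 mulr1 mul1r.
Qed.

Lemma det_posdef_schur k (M : 'M[R]_(1 + k)) : posdef M ->
  \det M = M 0 0 * \det (schur M).
Proof.
move=> pM; have a0 := posdef_corner_gt0 pM.
rewrite [X in \det X](posdef_block pM) det_block_schur; last first.
  by rewrite unitmxE det_scalar1 unitfE gt_eqF.
rewrite det_scalar1; congr (_ * \det _); congr (_ - _).
by rewrite invmx_scalar mul_mx_scalar -scalemxAl.
Qed.

Lemma posdef_det_gt0 n (M : 'M[R]_n) : posdef M -> 0 < \det M.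
Proof.
elim: n M => [|k IH] M pM; first by rewrite det_mx00.
rewrite (@det_posdef_schur k)// mulr_gt0//; first exact: (@posdef_corner_gt0 k).
exact/IH/posdef_schur.
Qed.

(** Sylvester's determinant identity: both sides are the determinant of one
    block matrix, factored in two ways. *)
Lemma det_1addmulC m n (A : 'M[R]_(m, n)) (B : 'M[R]_(n, m)) :
  \det (1%:M + A *m B) = \det (1%:M + B *m A).
Proof.
have <- : \det (block_mx 1%:M (- A) B 1%:M) = \det (1%:M + B *m A).
  by rewrite det_block_schur ?unitmx1// det1 mul1r invmx1 mulmx1 mulmxN opprK.
have -> : block_mx 1%:M (- A) B 1%:M = block_mx (1%:M + A *m B) (- A) 0 1%:M *m
    block_mx 1%:M 0 B 1%:M.
  rewrite mulmx_block ?(mulmx1, mulmx0, mul0mx, mul1mx, addr0, add0r) mulNmx.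
  by rewrite addrK.
by rewrite det_mulmx det_lblock det_ublock !det1 !mulr1.
Qed.

Definition gram n r (D : 'M[R]_(n, r)) : 'M[R]_r := D^T *m D.

(** The orthogonal projection onto the column space of [D]; this reading is
    only valid when the Gram matrix of [D] is invertible. *)
Definition proj n r (D : 'M[R]_(n, r)) : 'M[R]_n := D *m invmx (gram D) *m D^T.

Lemma tr_gram n r (D : 'M[R]_(n, r)) : (gram D)^T = gram D.
Proof. by rewrite /gram trmx_mul trmxK. Qed.

Lemma tr_proj n r (D : 'M[R]_(n, r)) : (proj D)^T = proj D.
Proof. by rewrite /proj !trmx_mul trmxK trmx_inv tr_gram mulmxA. Qed.

Lemma proj_idem n r (D : 'M[R]_(n, r)) : gram D \in unitmx ->
  proj D *m proj D = proj D.
Proof.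
move=> uD; rewrite /proj !mulmxA -[X in X *m _ *m _]mulmxA -/(gram D).
by rewrite -[X in X *m _ *m _]mulmxA mulVmx// mulmx1.
Qed.

(** Appending a column multiplies the Gram determinant by the squared distance
    from that column to the span of the others. *)
Lemma det_gram_row_mx n r (D : 'M[R]_(n, r)) (g : 'cV[R]_n) :
  gram D \in unitmx ->
  \det (gram (row_mx D g)) = \det (gram D) * qform (1%:M - proj D) g.
Proof.
move=> uD; rewrite {1}/gram tr_row_mx mul_col_row det_block_schur//.
congr (_ * _); rewrite det_mx11 qformD qformN /qform mulmx1 mxE; congr (_ + _).
by rewrite mxE /proj !mulmxA.
Qed.

Lemma tr_proj_compl n r (D : 'M[R]_(n, r)) :
  (1%:M - proj D)^T = 1%:M - proj D.
Proof. by rewrite [LHS]linearB /= tr_scalar_mx tr_proj. Qed.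

Lemma proj_compl_idem n r (D : 'M[R]_(n, r)) : gram D \in unitmx ->
  1%:M - proj D = (1%:M - proj D)^T *m (1%:M - proj D).
Proof.
move=> uD; rewrite tr_proj_compl mulmxBl mul1mx mulmxBr mulmx1.
by rewrite proj_idem// subrr subr0.
Qed.

(** The identity on the column space of [D], scaling by [e] on its orthogonal
    complement. *)
Definition stretch n r (e : R) (D : 'M[R]_(n, r)) : 'M[R]_n :=
  proj D + e *: (1%:M - proj D).

Lemma posdef_stretch n r e (D : 'M[R]_(n, r)) : 0 < e -> gram D \in unitmx ->
  posdef (stretch e D).
Proof.
move=> e0 uD; split.
  by rewrite /stretch [LHS]linearD /= linearZ /= tr_proj_compl tr_proj.
have PP : proj D = (proj D)^T *m proj D by rewrite tr_proj proj_idem.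
have QQ := proj_compl_idem uD.
move=> u u0; rewrite /stretch qformD qformZ.
have p0 : 0 <= qform (proj D) u by rewrite PP qform_gram_ge0.
have q0 : 0 <= qform (1%:M - proj D) u by rewrite QQ qform_gram_ge0.
rewrite lt_def; apply/andP; split; last by rewrite addr_ge0// mulr_ge0// ltW.
have eq0 : 0 <= e * qform (1%:M - proj D) u by rewrite mulr_ge0// ltW.
apply/eqP => /eqP; rewrite paddr_eq0//.
rewrite mulf_eq0 (gt_eqF e0) /= => /andP[/eqP Pu /eqP Qu].
have {}Pu : proj D *m u = 0 by apply: qform_gram_eq0; rewrite -PP.
have : (1%:M - proj D) *m u = 0 by apply: qform_gram_eq0; rewrite -QQ.
by rewrite mulmxBl mul1mx Pu subr0 => /eqP; rewrite (negbTE u0).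
Qed.

(** The orthogonal complement has dimension [n - r]; Sylvester's identity
    reduces the computation to a scalar matrix of size [r]. *)
Lemma det_stretch n r e (D : 'M[R]_(n, r)) : (r <= n)%N -> e != 0 ->
  gram D \in unitmx -> \det (stretch e D) = e ^+ (n - r).
Proof.
move=> rn e0 uD.
have -> : stretch e D = e *: (1%:M + D *m (- (1 - e^-1) *: (invmx (gram D) *m D^T))).
  rewrite /stretch -scalemxAr mulmxA -/(proj D) !scalerDr scalerN scalerA.
  have -> : e * - (1 - e^-1) = 1 - e by field.
  by rewrite scalerBl scale1r addrCA.
rewrite detZ det_1addmulC -scalemxAl -mulmxA -/(gram D) mulVmx//.
rewrite scaleNr scalerBl scale1r opprB addrC subrK scalemx1 det_scalar.
by rewrite expfB_cond ?(negbTE e0) // exprVn.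
Qed.

Lemma qform_1_stretch n r e (D : 'M[R]_(n, r)) u :
  qform (1%:M - stretch e D) u = (1 - e) * qform (1%:M - proj D) u.
Proof.
rewrite -qformZ; congr qform.
by rewrite /stretch scalerBl scale1r opprD addrA.
Qed.

End QuadraticForms.

(** * Integrating out one coordinate of an independent family *)

Section Independence.
Context {R : realType} {d : measure_display} {T : measurableType d}.
Context (P : probability T R) {I : choiceType} (X : I -> {RV P >-> R}).

(** The finite cylinders not involving the index [i].  They form a pi-system
    generating the sigma-algebra of the family [X j], [j != i]. *)
Definition cylinders_without (i : I) : set (set T) :=
  [set A | exists (J : {fset I}) (B : I -> set R),
    [/\ i \notin J, forall j, j \in J -> measurable (B j) &
        A = \bigcap_(j in [set` J]) (X j @^-1` B j)]].

Lemma measurable_RV_preimage (j : I) (B : set R) :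
  measurable B -> measurable (X j @^-1` B).
Proof. by move=> mB; rewrite -[X in measurable X]setTI; exact: measurable_funPT. Qed.

Lemma cylinders_without_measurable (i : I) :
  cylinders_without i `<=` measurable.
Proof.
move=> _ [J [B [_ mB ->]]]; apply: fin_bigcap_measurable => //.
by move=> j /= jJ; apply: measurable_RV_preimage; exact: mB.
Qed.

Lemma cylinders_withoutT (i : I) : cylinders_without i setT.
Proof.
exists fset0, (fun=> setT); split => //.
by apply/esym/seteqP; split.
Qed.

Lemma cylinders_without_setI (i : I) : setI_closed (cylinders_without i).
Proof.
move=> _ _ [J [B [iJ mB ->]]] [K [C [iK mC ->]]].
exists (J `|` K)%fset.
exists (fun j => (if j \in J then B j else setT) `&` (if j \in K then C j else setT)).
split.
- by rewrite in_fsetU negb_or iJ iK.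
- move=> j _; apply: measurableI; case: ifP => // ?; [exact: mB|exact: mC].
- apply/seteqP; split => w /=.
    move=> [HJ HK] j /= _; split.
      by case: ifP => // jJ; exact: HJ.
    by case: ifP => // jK; exact: HK.
  move=> H; split => j /= jJ.
    by have /= := H j; rewrite in_fsetU jJ => /(_ isT)[].
  by have /= := H j; rewrite in_fsetU jJ orbT => /(_ isT)[].
Qed.

Hypothesis indep : mutually_independent X.

(** [X i] is independent of the sigma-algebra generated by all the other
    variables: two finite measures agreeing on a pi-system. *)
Lemma independent_of_others (i : I) (A : set T) (B : set R) :
  <<s cylinders_without i >> A -> measurable B ->
  P (A `&` X i @^-1` B) = (P A * P (X i @^-1` B))%E.
Proof.
move=> sA mB; have mXB := measurable_RV_preimage i mB.
have pfin : P (X i @^-1` B) \is a fin_num by exact: fin_num_measure.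
pose r : {nonneg R} := NngNum (fine_ge0 (measure_ge0 P (X i @^-1` B))).
have rE : (r%:num)%:E = P (X i @^-1` B) by rewrite /= fineK.
rewrite muleC -rE.
rewrite -[LHS]/(mrestr P mXB A) -[RHS]/(mscale r P A).
apply: (g_sigma_algebra_measure_unique (cylinders_without i) _ (fun=> setT)) => //.
- exact: cylinders_without_measurable.
- by move=> _; exact: cylinders_withoutT.
- by rewrite bigcup_const//; exists 0%N.
- exact: cylinders_without_setI.
- move=> _ [J [C [iJ mC ->]]]; rewrite /= /mrestr /mscale rE.
  pose C' j := if j == i then B else C j.
  have := indep (J := (i |` J)%fset) (A := C').
  have -> : \bigcap_(j in [set` (i |` J)%fset]) (X j @^-1` C' j) =
      \bigcap_(j in [set` J]) (X j @^-1` C j) `&` X i @^-1` B.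
    apply/seteqP; split => w /=.
      move=> H; split => [j /= jJ|].
        have /= := H j; rewrite !inE jJ orbT => /(_ isT); rewrite /C'.
        by case: eqP jJ => // ->; rewrite (negbTE iJ).
      by have /= := H i; rewrite !inE eqxx => /(_ isT); rewrite /C' eqxx.
    move=> [H1 H2] j /=; rewrite !inE /C'; case: eqP => [-> //|_ /= jJ].
    exact: H1.
  move=> ->; last first.
    by move=> j; rewrite !inE /C'; case: eqP => //= _; exact: mC.
  rewrite big_fsetU1//= {1}/C' eqxx; congr (_ * _)%E.
  have HJ : P (\bigcap_(j in [set` J]) (X j @^-1` C j)) =
     (\prod_(j <- J) P (X j @^-1` C j))%E by exact: indep.
  rewrite HJ; apply: eq_big_seq => j jJ; rewrite /C'.
  by case: eqP jJ => // ->; rewrite (negbTE iJ).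
- move=> _; change (P ([set: T] `&` X i @^-1` B) < +oo)%E; rewrite setTI.
  by rewrite (le_lt_trans (probability_le1 _ _)) ?ltry.
Qed.

(* The sample space with the sigma-algebra of the variables other than [X i]. *)
Local Notation space_without i := (g_sigma_algebraType (cylinders_without i)).

Lemma measurable_others (i j : I) : j != i ->
  measurable_fun [set: space_without i] (X j : space_without i -> R).
Proof.
move=> ji _ B mB; rewrite setTI; apply: sub_sigma_algebra.
exists [fset j]%fset, (fun=> B); split => //.
  by rewrite inE eq_sym.
apply/seteqP; split => w /=.
  by move=> H k /=; rewrite inE => /eqP ->.
by move=> /(_ j) /=; rewrite inE eqxx => /(_ isT).
Qed.

Lemma measurable_forget (i : I) :
  measurable_fun [set: T] (id : T -> space_without i).
Proof.
move=> _ B mB; rewrite setTI.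
exact: (smallest_sub (@sigma_algebra_measurable _ T)
         (@cylinders_without_measurable i)).
Qed.

(** Fubini along one coordinate: if [f] depends on the sample only through the
    variables other than [X i], then [X i] may be replaced by an independent
    standard Gaussian.  The second factor is [measurableTypeR R] because this is
    the carrier of [normal_prob]. *)
Lemma expectation_integrate_out (i : I)
    (f : space_without i * measurableTypeR R -> \bar R) :
  standard_normal (X i) -> measurable_fun setT f -> (forall z, (0 <= f z)%E) ->
  (\int[P]_w f (w, X i w) = \int[P]_w \int[normal_prob 0 1]_x f (w, x))%E.
Proof.
move=> Xn mf f0.
have mid := @measurable_forget i.
pose h : T -> space_without i * measurableTypeR R :=
  fun w => (w : space_without i, X i w).
have mh : measurable_fun setT h.
  by apply/measurable_fun_pairP; split => //=; exact: (@measurable_funPT _ _ _ _ (X i)).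
pose Ymixin := isMeasurableFun.Build _ _ _ _ _ mid.
pose Y : {mfun T >-> space_without i} := HB.pack (id : T -> space_without i) Ymixin.
pose Zmixin := isMeasurableFun.Build _ _ _ _ _ mh.
pose Z : {mfun T >-> (space_without i * measurableTypeR R)%type} := HB.pack h Zmixin.
(* The joint law of the identity and of [X i] is a product measure. *)
have HZ : forall S, measurable S ->
    (distribution P Y \x normal_prob 0 1)%E S = distribution P Z S.
  apply: product_measure_unique => A B mA mB.
  rewrite /= -Xn// /distribution /pushforward /= -independent_of_others//.
transitivity (\int[distribution P Z]_z f z)%E.
  by rewrite ge0_integral_pushforward//=.
transitivity (\int[distribution P Y \x normal_prob 0 1]_z f z)%E.
  by apply: eq_measure_integral => A mA _; exact/esym/HZ.
rewrite fubini_tonelli1//= ge0_integral_pushforward//=.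
- exact: measurable_fun_fubini_tonelli_F.
- by move=> z _; apply: integral_ge0.
Qed.
End Independence.

(** * Gaussian expectations of exponentials of quadratic forms *)

Section GaussianIntegral.
Context {R : realType}.

Lemma ge0_integral_normal_prob (m s : R) (f : measurableTypeR R -> \bar R) :
  measurable_fun setT f -> (forall x, 0 <= f x)%E ->
  (\int[normal_prob m s]_x f x =
   \int[lebesgue_measure]_x (f x * (normal_pdf m s x)%:E))%E.
Proof.
move=> mf f0; have dom := normal_prob_dominates m s.
rewrite -(Radon_Nikodym_SigmaFinite.change_of_variables dom)//.
have iRN := Radon_Nikodym_SigmaFinite.f_integrable dom.
have mpdf : measurable_fun setT (fun x => (normal_pdf m s x)%:E : \bar R).
  by apply/measurable_EFinP; exact: measurable_normal_pdf.
apply: ae_eq_integral => //.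
- by apply: emeasurable_funM => //; exact: measurable_int iRN.
- exact: emeasurable_funM.
- apply: ae_eqe_mul2l; apply: integral_ae_eq => // E _ mE.
  by rewrite -Radon_Nikodym_SigmaFinite.f_integral.
Qed.

Lemma measurable_linear_quadratic (a c : R) :
  measurable_fun [set: measurableTypeR R]
    (fun x => expR (((1 - a) * x ^+ 2 - 2 * c * x) / 2)).
Proof.
apply: measurableT_comp => //.
apply: measurable_funM => //; apply: measurable_funB => //.
by apply: measurable_funM => //; exact: measurable_funX.
Qed.

(** Completing the square: up to a constant, the integrand times the standard
    Gaussian density is the Gaussian density of mean [- c / a] and variance
    [a^-1]. *)
Lemma gaussian_linear_quadratic (a c : R) : 0 < a ->
  (\int[normal_prob 0 1]_x (expR (((1 - a) * x ^+ 2 - 2 * c * x) / 2))%:E =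
   (a `^ (- 2^-1) * expR (c ^+ 2 / (2 * a)))%:E)%E.
Proof.
move=> a0; rewrite ge0_integral_normal_prob; last 2 first.
- by apply/measurable_EFinP; exact: measurable_linear_quadratic.
- by move=> x; rewrite lee_fin expR_ge0.
pose s := a `^ (- 2^-1).
have s0 : 0 < s by rewrite powR_gt0.
have s2 : s ^+ 2 = a^-1.
  by rewrite -powR_mulrn ?ltW// -powRrM mulNr mulVf// powR_inv1// ltW.
have peak_s : normal_peak 1 = s * normal_peak s.
  rewrite /normal_peak expr1n mul1r -mulrnAr sqrtrM ?sqr_ge0// sqrtr_sqr.
  by rewrite (gtr0_norm s0) invfM mulrA divff ?mul1r// gt_eqF.
transitivity (\int[lebesgue_measure]_(x in setT)
   ((s * expR (c ^+ 2 / (2 * a)))%:E * (normal_pdf (- c / a) s x)%:E))%E.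
  apply: eq_integral => x _; rewrite -!EFinM; congr EFin.
  rewrite /normal_pdf oner_eq0 (gt_eqF s0) peak_s /normal_fun s2.
  rewrite [LHS]mulrCA [RHS]mulrACA -!expRD; congr (_ * expR _).
  field; by rewrite gt_eqF.
rewrite ge0_integralZl_EFin//=.
- by rewrite integral_normal_pdf mule1.
- by move=> x _; rewrite lee_fin normal_pdf_ge0.
- by apply/measurable_EFinP; exact: measurable_normal_pdf.
- by rewrite mulr_ge0 ?expR_ge0// ltW.
Qed.
End GaussianIntegral.

Section MeasurableMatrices.
Context {R : realType} {d : measure_display} {T : measurableType d}.

(** Entrywise measurability of a random matrix. *)
Definition measurable_mx m n (M : T -> 'M[R]_(m, n)) : Prop :=
  forall i j, measurable_fun [set: T] (fun w => M w i j).

(** Real powers are measurable, and the identity 1/y = y (y^2)^(-1) holds also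
    at y = 0, where both sides are 0. *)
Lemma measurable_fun_inverse (f : T -> R) :
  measurable_fun setT f -> measurable_fun setT (fun w => (f w)^-1).
Proof.
move=> mf; pose g w := f w * (f w ^+ 2) `^ (-1).
have -> : (fun w => (f w)^-1) = g.
  apply/funext => w; rewrite /g powR_inv1 ?sqr_ge0//.
  have [->|f0] := eqVneq (f w) 0; first by rewrite invr0 mul0r.
  by field.
apply: measurable_funM => //; apply: (measurableT_comp (measurable_powR _)).
exact: measurable_funX.
Qed.

Lemma measurable_mx_cst m n (M : 'M[R]_(m, n)) : measurable_mx (fun=> M).
Proof. by move=> i j; exact: measurable_cst. Qed.

Lemma measurable_mxD m n (M N : T -> 'M[R]_(m, n)) :
  measurable_mx M -> measurable_mx N -> measurable_mx (fun w => M w + N w).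
Proof.
move=> mM mN i j; under eq_fun do rewrite mxE; exact: measurable_funD.
Qed.

Lemma measurable_mxZ m n (f : T -> R) (M : T -> 'M[R]_(m, n)) :
  measurable_fun setT f -> measurable_mx M -> measurable_mx (fun w => f w *: M w).
Proof.
move=> mf mM i j; under eq_fun do rewrite mxE; exact: measurable_funM.
Qed.

Lemma measurable_mxB m n (M N : T -> 'M[R]_(m, n)) :
  measurable_mx M -> measurable_mx N -> measurable_mx (fun w => M w - N w).
Proof.
move=> mM mN i j; under eq_fun do rewrite !mxE; exact: measurable_funB.
Qed.

Lemma measurable_mx_tr m n (M : T -> 'M[R]_(m, n)) :
  measurable_mx M -> measurable_mx (fun w => (M w)^T).
Proof. by move=> mM i j; under eq_fun do rewrite mxE; exact: mM. Qed.

Lemma measurable_mxM m n p (M : T -> 'M[R]_(m, n)) (N : T -> 'M[R]_(n, p)) :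
  measurable_mx M -> measurable_mx N -> measurable_mx (fun w => M w *m N w).
Proof.
move=> mM mN i j; under eq_fun do rewrite mxE.
by apply: measurable_sum => k; exact: measurable_funM.
Qed.

Lemma measurable_det n (M : T -> 'M[R]_n) :
  measurable_mx M -> measurable_fun setT (fun w => \det (M w)).
Proof.
move=> mM; apply: measurable_sum => s; apply: measurable_funM => //.
by apply: measurable_prod => i _; exact: mM.
Qed.

Lemma measurable_invmx n (M : T -> 'M[R]_n) :
  measurable_mx M -> measurable_mx (fun w => invmx (M w)).
Proof.
move=> mM i j; have mdet := measurable_det mM.
have -> : (fun w => invmx (M w) i j) = (fun w => if \det (M w) == 0 then M w i j
    else (\det (M w))^-1 * \adj (M w) i j).
  apply/funext => w; rewrite /invmx unitmxE unitfE.
  by case: eqP => //= _; rewrite mxE.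
apply: measurable_fun_ifT => //; first exact: measurable_fun_eqr.
apply: measurable_funM; first exact: measurable_fun_inverse.
under eq_fun do rewrite mxE; apply: measurable_funM => //.
by apply: measurable_det => k l; under eq_fun do rewrite !mxE; exact: mM.
Qed.

Lemma measurable_qform n (M : T -> 'M[R]_n) (u : T -> 'cV[R]_n) :
  measurable_mx M -> measurable_mx u ->
  measurable_fun setT (fun w => qform (M w) (u w)).
Proof.
move=> mM mu; apply: (measurable_mxM _ mu).
by apply: measurable_mxM => //; exact: measurable_mx_tr.
Qed.

Lemma measurable_mx_schur k (M : T -> 'M[R]_(1 + k)) :
  measurable_mx M -> measurable_mx (fun w => schur (M w)).
Proof.
move=> mM; have mdl : measurable_mx (fun w => dlsubmx (M w)).
  by move=> i j; under eq_fun do rewrite !mxE; exact: mM.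
apply: measurable_mxB.
  by move=> i j; under eq_fun do rewrite !mxE; exact: mM.
apply: measurable_mxZ; first exact: measurable_fun_inverse.
by apply: measurable_mxM => //; exact: measurable_mx_tr.
Qed.

Lemma measurable_mx_proj n r (D : T -> 'M[R]_(n, r)) :
  measurable_mx D -> measurable_mx (fun w => proj (D w)).
Proof.
move=> mD; have mDT := measurable_mx_tr mD.
apply: measurable_mxM => //; apply: measurable_mxM => //.
by apply: measurable_invmx; exact: measurable_mxM.
Qed.

End MeasurableMatrices.

Section GaussianVector.
Context {R : realType} {d : measure_display} {T : measurableType d}.
Context {P : probability T R} {I : choiceType} (X : I -> {RV P >-> R}).
Hypothesis indep : mutually_independent X.
Hypothesis normal : forall i, standard_normal (X i).

Local Notation space_without i := (g_sigma_algebraType (cylinders_without X i)).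

(** The Gaussian vector has coordinates [X (iota i)], and [phi] and [M] do not
    depend on any of them.  Induction on the dimension: integrating out the first
    coordinate turns [M] into its Schur complement and multiplies [phi] by the
    inverse square root of the corner entry of [M]. *)
Lemma expectation_gaussian_qform n (iota : 'I_n -> I) (phi : T -> R)
    (M : T -> 'M[R]_n) :
  injective iota ->
  (forall i, measurable_fun [set: space_without (iota i)] phi) ->
  (forall i, @measurable_mx _ _ (space_without (iota i)) _ _ M) ->
  (forall w, 0 <= phi w) -> (forall w, posdef (M w)) ->
  (\int[P]_w (phi w * expR (qform (1%:M - M w) (\col_i X (iota i) w) / 2))%:E =
   \int[P]_w (phi w * (\det (M w)) `^ (- 2^-1))%:E)%E.
Proof.
elim: n iota phi M => [|k IH] iota phi M inj_iota mphi mM phi0 Mpos.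
  apply: eq_integral => w _; rewrite det_mx00 powR1.
  by rewrite qformE big_ord0 mul0r expR0.
have mX i j : i != j -> measurable_fun [set: space_without (iota i)] (X (iota j)).
  move=> ij; apply: measurable_others.
  by apply: contra ij => /eqP /inj_iota ->.
pose iota' j := iota (rshift 1 j).
pose u w := \col_j X (iota' j) w.
pose c w := ((@dlsubmx R 1 k 1 k (M w))^T *m u w) 0 0.
pose q w := qform (1%:M - @drsubmx R 1 k 1 k (M w)) (u w).
have expand w x : qform (1%:M - (M w : 'M[R]_(1 + k))) (col_mx x%:M (u w)) =
    (1 - M w 0 0) * x ^+ 2 - 2 * c w * x + q w.
  exact: (qform_1_posdef_block _ _ (Mpos w)).
have colE w : \col_i X (iota i) w = col_mx (X (iota ord0) w)%:M (u w).
  apply/matrixP => i j; rewrite !ord1 [LHS]mxE; case: (@split_ordP 1 k i) => l ->.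
    rewrite (@col_mxEu _ 1 k 1 (X (iota ord0) w)%:M (u w) l 0) !ord1 mxE eqxx.
    by rewrite mulr1n; congr (X (iota _) w); exact/val_inj.
  by rewrite (@col_mxEd _ 1 k 1 (X (iota ord0) w)%:M (u w) l 0) mxE.
pose F (z : space_without (iota ord0) * measurableTypeR R) : \bar R :=
  (phi z.1 * expR (((1 - M z.1 0 0) * z.2 ^+ 2 - 2 * c z.1 * z.2 + q z.1) / 2))%:E.
have -> : (\int[P]_w (phi w * expR (qform (1%:M - M w) (\col_i X (iota i) w) / 2))%:E
   = \int[P]_w F (w, X (iota ord0) w))%E.
  by apply: eq_integral => w _; rewrite colE expand.
have F0 z : (0 <= F z)%E by rewrite lee_fin mulr_ge0 ?expR_ge0.
have mF : measurable_fun setT F.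
  have mu : @measurable_mx _ _ (space_without (iota ord0)) _ _ u.
    by move=> i j; under eq_fun do rewrite mxE; exact: mX.
  have ma : measurable_fun [set: space_without (iota ord0)] (fun w => M w 0 0).
    exact: mM.
  have mdl : @measurable_mx _ _ (space_without (iota ord0)) _ _
      (fun w => @dlsubmx R 1 k 1 k (M w)).
    by move=> i j; under eq_fun do rewrite !mxE; exact: mM.
  have mc : measurable_fun [set: space_without (iota ord0)] c.
    by apply: measurable_mxM => //; exact: measurable_mx_tr.
  have mq : measurable_fun [set: space_without (iota ord0)] q.
    apply: measurable_qform => //; apply: measurable_mxB.
      exact: measurable_mx_cst.
    by move=> i j; under eq_fun do rewrite !mxE; exact: mM.
  have m1 (f : T -> R) : measurable_fun [set: space_without (iota ord0)] f ->
      measurable_fun [set: space_without (iota ord0) * measurableTypeR R]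
        (fun z => f z.1).
    by move=> mf; exact: (measurableT_comp mf measurable_fst).
  have m2 : measurable_fun [set: space_without (iota ord0) * measurableTypeR R]
      (fun z => z.2 : R).
    exact: measurable_snd.
  apply/measurable_EFinP; apply: measurable_funM; first exact: m1.
  apply: measurableT_comp => //; apply: measurable_funM => //.
  apply: measurable_funD; last exact: m1.
  apply: measurable_funB; apply: measurable_funM => //.
  - by apply: measurable_funB => //; exact: (m1 _ ma).
  - exact: measurable_funX.
  - by apply: measurable_funM => //; exact: m1.
rewrite expectation_integrate_out//.
pose phi' w := phi w * (M w 0 0) `^ (- 2^-1).
transitivity (\int[P]_w (phi' w *
   expR (qform (1%:M - schur (M w : 'M[R]_(1 + k))) (u w) / 2))%:E)%E.
  apply: eq_integral => w _.
  have a0 := posdef_corner_gt0 (Mpos w : @posdef _ (1 + k) _).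
  pose b := phi w * expR (q w / 2).
  transitivity (\int[normal_prob 0 1]_x
    (b%:E * (expR (((1 - M w 0 0) * x ^+ 2 - 2 * c w * x) / 2))%:E))%E.
    apply: eq_integral => x _; rewrite /F /= -EFinM /b; congr EFin.
    rewrite -[RHS]mulrA -expRD; congr (_ * expR _).
    by rewrite -mulrDl addrC.
  rewrite ge0_integralZl_EFin//=; last 2 first.
  - by apply/measurable_EFinP; exact: measurable_linear_quadratic.
  - by rewrite mulr_ge0 ?expR_ge0.
  rewrite gaussian_linear_quadratic// -EFinM /b /phi' -!mulrA; congr (_ * _)%:E.
  rewrite mulrCA; congr (_ * _); rewrite -expRD; congr expR.
  rewrite qformD qformN qform_schur -/(c w) /q qformD qformN.
  field.
  by rewrite gt_eqF.
rewrite (IH iota').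
- apply: eq_integral => w _; rewrite /phi' -mulrA; congr (_ * _)%:E.
  have pM := Mpos w : @posdef _ (1 + k) _.
  rewrite (det_posdef_schur pM) powRM// ?ltW ?posdef_corner_gt0//.
  exact/posdef_det_gt0/posdef_schur.
- by move=> i j /inj_iota /(congr1 val) ij; apply: val_inj; case: ij.
- move=> i; apply: measurable_funM; first exact: mphi.
  apply: (measurableT_comp (measurable_powR _)); exact: mM.
- by move=> i; apply: measurable_mx_schur; exact: mM.
- by move=> w; rewrite mulr_ge0 ?powR_ge0.
- by move=> w; exact: posdef_schur.
Qed.
End GaussianVector.

(** * Concentration of the increments of the Gram determinant *)

Section GramIncrement.
Context {R : realType}.
Implicit Types b : nat -> nat -> R.

(** The determinant of B'B for the n by r array [b], without the factor 1/n. *)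
Definition gram_det b n r : R := \det (gram (data_mx b n r)).

(** The squared distance from column [r] to the span of the columns before it,
    when these are linearly independent. *)
Definition dist2 b n r : R :=
  qform (1%:M - proj (data_mx b n r)) (\col_(i < n) b i r).

Lemma gram_det0 b n : gram_det b n 0 = 1.
Proof. exact: det_mx00. Qed.

Lemma gram_detS b n r : gram_det b n r != 0 ->
  gram_det b n r.+1 = gram_det b n r * dist2 b n r.
Proof.
move=> u; rewrite -addn1 /gram_det.
have -> : data_mx b n (r + 1) = row_mx (data_mx b n r) (\col_(i < n) b i r).
  apply/matrixP => i j; rewrite mxE; case: (split_ordP j) => k ->.
    by rewrite row_mxEl mxE.
  by rewrite row_mxEr mxE /= ord1 addn0.
by rewrite det_gram_row_mx// unitmxE unitfE.
Qed.

End GramIncrement.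

Section Chernoff.
Context {R : realType} {d : measure_display} {T : measurableType d}.
Context {P : probability T R} (b : nat -> nat -> {RV P >-> R}).
Hypothesis b_normal : forall i j, standard_normal (b i j).
Hypothesis b_indep : mutually_independent (fun ij : nat * nat => b ij.1 ij.2).

Local Notation array w := (fun i j => b i j w).

Lemma measurable_set_of_bool d' (U : measurableType d') (f : U -> bool) :
  measurable_fun setT f -> measurable [set w | f w].
Proof.
move=> mf; rewrite (_ : [set w | f w] = setT `&` f @^-1` [set true]).
  exact: mf.
by rewrite setTI.
Qed.

Lemma measurable_data_mx n r :
  measurable_mx (fun w => data_mx (array w) n r).
Proof. by move=> i j; under eq_fun do rewrite mxE; exact: measurable_funPT. Qed.

Lemma measurable_gram_det n r :
  measurable_fun [set: T] (fun w => gram_det (array w) n r).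
Proof.
apply: measurable_det; have mD := @measurable_data_mx n r.
by apply: measurable_mxM => //; exact: measurable_mx_tr.
Qed.

Lemma measurable_col n r :
  measurable_mx (fun w => (\col_(i < n) b i r w) : 'cV[R]_n).
Proof. by move=> i j; under eq_fun do rewrite mxE; exact: measurable_funPT. Qed.

Lemma measurable_dist2 n r :
  measurable_fun [set: T] (fun w => dist2 (array w) n r).
Proof.
apply: measurable_qform; last exact: measurable_col.
apply: measurable_mxB; first exact: measurable_mx_cst.
by apply: measurable_mx_proj; exact: measurable_data_mx.
Qed.

(** For s > 0 the event that [dist2] is at most (n - r) e^(-s); for s < 0 the
    event that it is at least (n - r) e^(-s), the common factor (e^s - 1)/2 being
    then negative.  In both cases the Gram determinant of the earlier columns is
    required to be nonzero. *)
Definition deviation_set n r (s : R) : set T :=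
  [set w | (gram_det (array w) n r != 0) &&
     ((expR s - 1) / 2 * dist2 (array w) n r <=
      (expR s - 1) / 2 * ((n - r)%:R * expR (- s)))].

Lemma measurable_deviation_set n r s : measurable (deviation_set n r s).
Proof.
apply: measurable_set_of_bool; apply: measurable_and.
- apply: measurable_neg; apply: measurable_fun_eqr => //.
  exact: measurable_gram_det.
- apply: measurable_fun_ler => //; apply: measurable_funM => //.
  exact: measurable_dist2.
Qed.

(** Markov's inequality for the exponential of -(e^s - 1)/2 times [dist2]. *)
Lemma deviation_set_le n r s : (r < n)%N ->
  (P (deviation_set n r s) <=
   (expR ((n - r)%:R / 2 * (1 - expR (- s) - s)))%:E)%E.
Proof.
move=> rn; set m : R := (n - r)%:R; set lam := (expR s - 1) / 2.
pose D w := data_mx (array w) n r.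
(* Where the earlier columns are linearly dependent, the weight vanishes and [M]
   is set to the identity so as to be positive definite everywhere. *)
pose phi w := if gram_det (array w) n r == 0 then 0 else expR (lam * (m * expR (- s))).
pose M w : 'M[R]_n := if gram_det (array w) n r == 0 then 1%:M else stretch (expR s) (D w).
pose iota (i : 'I_n) := (nat_of_ord i, r).
have inj_iota : injective iota by move=> i j [] /val_inj.
have phi0 w : 0 <= phi w by rewrite /phi; case: ifP => // _; exact: expR_ge0.
have posdef1 : posdef (1%:M : 'M[R]_n).
  have -> : 1%:M = 1%:M^T *m 1%:M :> 'M[R]_n by rewrite mulmx1 tr_scalar_mx.
  split; first by rewrite mulmx1 !tr_scalar_mx.
  move=> u u0; rewrite lt_def qform_gram_ge0 andbT; apply/eqP => /qform_gram_eq0.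
  by move/eqP; rewrite mul1mx (negbTE u0).
have Mpos w : posdef (M w).
  rewrite /M; case: eqP => // /eqP u; apply: posdef_stretch; first exact: expR_gt0.
  by rewrite unitmxE unitfE.
(* Measurability for every sigma-algebra making the earlier columns measurable:
   it is needed for the full one and for those omitting one entry of column r. *)
have meas d' (U : measurableType d') (h : U -> T) :
    (forall i j, (j < r)%N -> measurable_fun [set: U] (fun w => b i j (h w))) ->
    measurable_fun [set: U] (fun w => phi (h w)) /\
    measurable_mx (fun w => M (h w)).
  move=> mb.
  have mD : measurable_mx (fun w => D (h w)).
    by move=> i j; under eq_fun do rewrite mxE; exact: mb.
  have mg : measurable_fun setT (fun w => gram_det (array (h w)) n r == 0).
    apply: measurable_fun_eqr => //; apply: measurable_det.
    by apply: measurable_mxM => //; exact: measurable_mx_tr.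
  split; first exact: measurable_fun_ifT.
  move=> i j.
  have -> : (fun w => M (h w) i j) = fun w =>
    if gram_det (array (h w)) n r == 0 then (1%:M : 'M[R]_n) i j
    else stretch (expR s) (D (h w)) i j by apply/funext => w; rewrite /M; case: ifP.
  apply: measurable_fun_ifT => //.
  have mp := measurable_mx_proj mD.
  apply: measurable_mxD => //; apply: measurable_mxZ => //.
  by apply: measurable_mxB => //; exact: measurable_mx_cst.
have mbT i j : (j < r)%N -> measurable_fun [set: T] (b i j).
  by move=> _; exact: measurable_funPT.
have [mphiT mMT] := meas _ T id mbT.
have mgT : measurable_mx (fun w => (\col_(i < n) b i r w) : 'cV[R]_n).
  exact: measurable_col.
rewrite -[deviation_set _ _ _]setIT -integral_indic//; last first.
  exact: measurable_deviation_set.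
apply: (@le_trans _ _
  (\int[P]_w (phi w * expR (qform (1%:M - M w) (\col_(i < n) b i r w) / 2))%:E)%E).
  apply: ge0_le_integral => //.
  - apply/measurable_EFinP; apply: measurable_indic.
    exact: measurable_deviation_set.
  - apply/measurable_EFinP; apply: measurable_funM => //.
    apply: measurableT_comp => //; apply: measurable_funM => //.
    apply: measurable_qform => //; apply: measurable_mxB; last exact: mMT.
    exact: measurable_mx_cst.
  move=> w _; rewrite lee_fin indicE; case: (boolP (w \in _)) => /=; last first.
    by move=> _; rewrite mulr_ge0 ?expR_ge0.
  rewrite inE /deviation_set /= => /andP[u le_s].
  rewrite /phi /M (negbTE u) -expRD -[leLHS]expR0 ler_expR.
  rewrite qform_1_stretch -/(dist2 (array w) n r).
  have -> : (1 - expR s) * dist2 (array w) n r / 2 = - (lam * dist2 (array w) n r).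
    by rewrite /lam; field.
  by rewrite subr_ge0.
pose X (ij : nat * nat) : {RV P >-> R} := b ij.1 ij.2.
have X_normal ij : standard_normal (X ij) by exact: b_normal.
have mX i i' j : (j < r)%N ->
    measurable_fun [set: g_sigma_algebraType (cylinders_without X (iota i))] (b i' j).
  move=> jr; apply: (@measurable_others _ _ _ _ _ X (iota i) (i', j)).
  by rewrite xpair_eqE negb_and (ltn_eqF jr) orbT.
have meas' i := meas _ (g_sigma_algebraType (cylinders_without X (iota i))) id (mX i).
rewrite (@expectation_gaussian_qform _ _ _ _ _ X b_indep X_normal _ iota)//; first last.
- by move=> i; case: (meas' i).
- by move=> i; case: (meas' i).
apply: (@le_trans _ _ (\int[P]_w (cst (expR (m / 2 * (1 - expR (- s) - s)))%:E w))%E).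
    apply: ge0_le_integral => //.
    + by move=> w _; rewrite lee_fin; apply: mulr_ge0; [exact: phi0|exact: powR_ge0].
    + apply/measurable_EFinP; apply: measurable_funM => //.
      by apply: (measurableT_comp (measurable_powR _)); exact: measurable_det.
    move=> w _; rewrite lee_fin /phi /M; case: eqP => [_|/eqP u].
      by rewrite mul0r expR_ge0.
    rewrite det_stretch ?gt_eqF ?expR_gt0 ?(ltnW rn)//; last first.
      by rewrite unitmxE unitfE.
    rewrite -expRM_natl -expRM -expRD ler_expR -/m.
    have -> : lam * (m * expR (- s)) = m / 2 * (expR s * expR (- s) - expR (- s)).
      by rewrite /lam; field.
    by rewrite expRxMexpNx_1 le_eqVlt; apply/orP; left; apply/eqP; field.
  by rewrite integral_cst//= probability_setT mule1.
Qed.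

End Chernoff.

(** * Entropy estimates for sums of logarithms *)

Section LogFactorial.
Context {R : realType}.
Implicit Types (n m r : nat).

Lemma ln_le_sub1 (y : R) : 0 < y -> ln y <= y - 1.
Proof.
have yE : 1 + (y - 1) = y by lra.
move=> y0; have := @le_ln1Dx R (y - 1); rewrite yE; apply; lra.
Qed.

Lemma ln_diff_le (u v : R) : 0 < u -> 0 < v -> ln v - ln u <= (v - u) / u.
Proof.
move=> u0 v0; rewrite -ln_div ?posrE//.
have -> : (v - u) / u = v / u - 1 by rewrite mulrBl divff// gt_eqF.
by apply: ln_le_sub1; rewrite divr_gt0.
Qed.

(** A primitive of the logarithm; its value at 0 is 0. *)
Definition entropy (x : R) : R := x * ln x - x.

(** Upper bound for the error accumulated, over the integers from 1 to [m], when
    log is replaced by the increment of [entropy]. *)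
Definition entropy_err m : R := if m is 0 then 0 else 1 + ln m%:R.

Lemma ln_entropy_step m :
  0 <= ln m.+1%:R - (entropy m.+1%:R - entropy m%:R) <=
  entropy_err m.+1 - entropy_err m.
Proof.
case: m => [|m]; first by rewrite /entropy /entropy_err ln1; apply/andP; split; lra.
rewrite /entropy /entropy_err; set a : R := m.+1%:R; set b : R := m.+2%:R.
have a0 : 0 < a by rewrite ltr0n.
have b0 : 0 < b by rewrite ltr0n.
have ab : b = a + 1 by rewrite /a /b -[m.+2]addn1 natrD.
have H1 := ln_diff_le a0 b0; have H2 := ln_diff_le b0 a0.
have {}H1 : a * (ln b - ln a) <= 1.
  by move: H1; rewrite ler_pdivlMr// mulrC => H1; lra.
have {}H2 : 1 <= b * (ln b - ln a).
  by move: H2; rewrite ler_pdivlMr// mulrC => H2; lra.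
by apply/andP; split; nra.
Qed.

Lemma sum_ln_entropy n r : (r <= n)%N ->
  0 <= \sum_(k < r) ln (n - k)%:R - (entropy n%:R - entropy (n - r)%:R) <=
  entropy_err n - entropy_err (n - r).
Proof.
elim: r => [|r IH] rn; first by rewrite big_ord0 subn0 !subrr lexx.
have {IH}/andP[IH1 IH2] := IH (ltnW rn).
have /andP[H1 H2] := ln_entropy_step (n - r.+1).
rewrite big_ord_recr /=; rewrite -subSn// subSS in H1 H2.
by apply/andP; split; lra.
Qed.

Lemma sum_ln_entropy_le n r : (0 < n)%N -> (r <= n)%N ->
  `|\sum_(k < r) ln (n - k)%:R - (entropy n%:R - entropy (n - r)%:R)| <= 1 + ln n%:R.
Proof.
move=> n0 rn; have /andP[H1 H2] := sum_ln_entropy rn.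
rewrite ger0_norm//; apply: le_trans H2 _.
rewrite /entropy_err; case: n n0 rn H1 => // n _ _ _.
case: (n.+1 - r)%N => [|m]; first by rewrite subr0.
have := @ln_ge0 R m.+1%:R; rewrite ler1n => /(_ isT); lra.
Qed.

(** Modulus of continuity of [entropy] at scale 1/n on [0, 1].  The point [v] is
    0 or at least 1/n, so that its logarithm is at least - log n; the point [u]
    may be arbitrarily small. *)
Lemma entropy_modulus n (u v : R) : (0 < n)%N -> 0 <= u -> u <= v ->
  v <= u + n%:R^-1 -> v <= 1 -> v = 0 \/ n%:R^-1 <= v -> (u = 0 -> v = 0) ->
  `|entropy v - entropy u| <= (2 + ln n%:R) / n%:R.
Proof.
move=> n0 u0 uv vu v1 vn uv0.
have n0' : 0 < n%:R :> R by rewrite ltr0n.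
have ni : 0 < n%:R^-1 :> R by rewrite invr_gt0.
have Ln0 : 0 <= ln n%:R :> R by rewrite ln_ge0// ler1n.
case: vn => [v0|vn].
  have -> : u = v by apply/le_anti; rewrite uv v0 u0.
  by rewrite subrr normr0 divr_ge0// ?addr_ge0// ltW.
have v0 : 0 < v by apply: lt_le_trans vn.
have {u0} u0 : 0 < u.
  by rewrite lt_neqAle u0 andbT eq_sym; apply/eqP => /uv0 v00; rewrite v00 ltxx in v0.
have H1 := ln_diff_le u0 v0.
have {}H1 : u * (ln v - ln u) <= v - u by rewrite mulrC -ler_pdivlMr.
have H2 : 0 <= ln v - ln u by rewrite subr_ge0 ler_ln ?posrE.
have H3 : ln v <= 0 by rewrite ln_le0.
have H4 : - ln n%:R <= ln v by rewrite -lnV ?posrE// ler_ln ?posrE.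
have -> : entropy v - entropy u = u * (ln v - ln u) + (v - u) * ln v - (v - u).
  by rewrite /entropy; ring.
have H5 : 0 <= u * (ln v - ln u) by rewrite mulr_ge0// ltW.
have H6 : (v - u) * ln n%:R <= n%:R^-1 * ln n%:R by apply: ler_wpM2r => //; lra.
have -> : (2 + ln n%:R) / n%:R = 2 * n%:R^-1 + n%:R^-1 * ln n%:R :> R by ring.
rewrite ler_norml; apply/andP; split; nra.
Qed.

End LogFactorial.

(** * Tolerances and their sum *)

Section Tolerance.
Context {R : realType}.

(** Rate functions for a chi-squared variable with m degrees of freedom to be
    at most m e^(-t), and at least m e^t: the probabilities are bounded by exp of
    - m/2 times these.  The function [cramer] below is the smaller of the two. *)
Definition cramer_lower (t : R) : R := t - 1 + expR (- t).
Definition cramer_upper (t : R) : R := expR t - 1 - t.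
Definition cramer (t : R) : R := Num.min (cramer_lower t) (cramer_upper t).

Lemma cramer_gt0 t : 0 < t -> 0 < cramer t.
Proof.
move=> t0; rewrite /cramer lt_min /cramer_lower /cramer_upper; apply/andP; split.
  by have := @expR_gt1Dx R (- t); rewrite oppr_eq0 gt_eqF// => /(_ isT); lra.
by have := @expR_gt1Dx R t; rewrite gt_eqF// => /(_ isT); lra.
Qed.

Lemma cramer_ge_sub1 t : 0 <= t -> t - 1 <= cramer t.
Proof.
move=> t0; rewrite /cramer le_min /cramer_lower /cramer_upper; apply/andP; split.
  by have := expR_ge0 (- t); lra.
have -> : t = t / 2 + t / 2 by field.
rewrite expRD; have := expR_ge1Dx (t / 2); set y := t / 2; set e := expR y.
have y0 : 0 <= y by rewrite /y divr_ge0.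
move=> H; have H1 : (1 + y) ^+ 2 <= e ^+ 2 by rewrite ler_sqr ?nnegrE; lra.
by have := sqr_ge0 (1 - y); lra.
Qed.

(** The logarithmic error allowed for a squared distance of mean [m]: [eps] when
    [m] is large enough for the Chernoff bound at [eps] to be at most n^(-3), and
    1 + 6 log n otherwise. *)
Definition tolerance (eps : R) (n m : nat) : R :=
  if 6 * ln n%:R <= m%:R * cramer eps then eps else 1 + 6 * ln n%:R.

Lemma tolerance_gt0 eps n m : 0 < eps -> (0 < n)%N -> 0 < tolerance eps n m.
Proof.
move=> e0 n0; rewrite /tolerance; case: ifP => // _.
by have := @ln_ge0 R n%:R; rewrite ler1n n0 => /(_ isT); lra.
Qed.

Lemma tolerance_cramer eps n m : (0 < m)%N -> (0 < n)%N ->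
  6 * ln n%:R <= m%:R * cramer (tolerance eps n m).
Proof.
move=> m0 n0; rewrite /tolerance; case: ifP => // _.
have L0 : 0 <= ln n%:R :> R by rewrite ln_ge0// ler1n.
have := @cramer_ge_sub1 (1 + 6 * ln n%:R); set c := cramer _ => H.
have {}H : 6 * ln n%:R <= c by apply: le_trans (H _); lra.
have m1 : 1 <= m%:R :> R by rewrite ler1n.
by nra.
Qed.

Lemma sum_count_lt (x : R) n : 0 <= x ->
  \sum_(k < n) (k.+1%:R < x)%R%:R <= x.
Proof.
move=> x0; elim: n => [|n IH]; first by rewrite big_ord0.
rewrite big_ord_recr /=; case: ltP => [nx|_]; last by rewrite addr0.
apply: le_trans (ltW nx); rewrite -natr1 lerD2r -[leRHS](mulr1) mulr_natl.
rewrite -[n in leRHS]card_ord -sumr_const; apply: ler_sum => k _.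
by case: ltP.
Qed.

(** At most x = 6 log n / [cramer eps] columns have the large tolerance. *)
Lemma sum_tolerance_le eps n r : 0 < eps -> (0 < n)%N -> (r <= n)%N ->
  \sum_(k < r) tolerance eps n (n - k) <=
  n%:R * eps + (6 * ln n%:R / cramer eps) * (1 + 6 * ln n%:R).
Proof.
move=> e0 n0 rn; have c0 := cramer_gt0 e0.
have L0 : 0 <= ln n%:R :> R by rewrite ln_ge0// ler1n.
set x := _ / _; have x0 : 0 <= x by rewrite /x divr_ge0 ?mulr_ge0// ltW.
pose f m : R := eps + (m%:R < x)%R%:R * (1 + 6 * ln n%:R).
have tf m : tolerance eps n m <= f m.
  rewrite /tolerance /f /x ltr_pdivlMr// [6 * _ <= _]leNgt.
  by case: ltP => _ /=; rewrite ?mul0r ?mul1r; lra.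
have f0 m : 0 <= f m by rewrite /f; case: ltP => _ /=; rewrite ?mul0r ?mul1r; lra.
apply: (@le_trans _ _ (\sum_(k < r) f (n - k)%N)); first exact: ler_sum.
apply: (@le_trans _ _ (\sum_(k < n) f (n - k)%N)).
  rewrite -!(big_mkord xpredT (fun k => f (n - k)%N)) [leRHS](big_cat_nat (leq0n r) rn)//=.
  by rewrite lerDl sumr_ge0.
rewrite (reindex_inj rev_ord_inj) /=.
have -> : \sum_(j < n) f (n - (n - j.+1))%N = \sum_(j < n) f j.+1.
  by apply: eq_bigr => j _; rewrite subKn.
rewrite big_split /= sumr_const card_ord (mulr_natl eps n) lerD2l -mulr_suml.
by apply: ler_wpM2r; [lra|exact: sum_count_lt].
Qed.

(** With y the cube root of n, 1 + log n <= 3 y, so the quotient is O(1/y). *)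
Lemma log_square_small (K delta : R) : 0 <= K -> 0 < delta ->
  \forall n \near \oo, K * (1 + ln n%:R) ^+ 2 / n%:R <= delta.
Proof.
move=> K0 d0; pose A := 9 * K / delta + 1.
have A1 : 1 <= A by rewrite /A lerDr divr_ge0 ?mulr_ge0// ltW.
exists (Num.truncn (A ^+ 3)).+1 => // n /= An.
have {}An : A ^+ 3 <= n%:R.
  by apply: ltW; apply: lt_le_trans (truncnS_gt _) _; rewrite ler_nat.
have n1 : 1 <= n%:R :> R by apply: le_trans An; exact: exprn_ege1.
set L := ln n%:R; have L0 : 0 <= L by exact: ln_ge0.
pose y := expR (L / 3); have y3 : y ^+ 3 = n%:R.
  by rewrite /y -expRM_natl mulrC divfK// lnK// posrE; lra.
have y0 : 0 < y by exact: expR_gt0.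
have A0 : 0 <= A by lra.
have Ay : A <= y by rewrite -(@ler_pXn2r _ 3) ?nnegrE ?y3 ?(ltW y0).
have Ly : 1 + L <= 3 * y by have := expR_ge1Dx (L / 3); rewrite -/y; lra.
rewrite -y3 ler_pdivrMr ?exprn_gt0//.
have H1 : (1 + L) ^+ 2 <= 9 * y ^+ 2.
  have -> : 9 * y ^+ 2 = (3 * y) ^+ 2 by ring.
  by rewrite ler_sqr ?nnegrE; lra.
apply: (@le_trans _ _ (K * (9 * y ^+ 2))); first exact: ler_wpM2l.
have -> : delta * y ^+ 3 = (delta * y) * y ^+ 2 by ring.
rewrite mulrA; apply: ler_wpM2r; first exact: sqr_ge0.
have : delta * A <= delta * y by rewrite ler_pM2l.
have -> : delta * A = 9 * K + delta by rewrite /A; field; rewrite gt_eqF.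
lra.
Qed.

End Tolerance.

(** * Log-determinants of typical arrays *)

Section Deterministic.
Context {R : realType}.
Implicit Types b : nat -> nat -> R.

(** Every increment of the Gram determinant of the [n]-row array is within
    tolerance, as long as the determinant has not vanished. *)
Definition typical b n eps : Prop :=
  forall r, (r < n)%N -> gram_det b n r != 0 ->
    0 < dist2 b n r /\
    `|ln (dist2 b n r) - ln (n - r)%:R| <= tolerance eps n (n - r).

Lemma typical_ln_gram_det b n eps r : typical b n eps -> (r <= n)%N ->
  0 < gram_det b n r /\
  `|ln (gram_det b n r) - \sum_(k < r) ln (n - k)%:R| <=
    \sum_(k < r) tolerance eps n (n - k).
Proof.
move=> typ; elim: r => [|r IH] rn.
  by rewrite gram_det0 ln1 !big_ord0 subrr normr0 ltr01.
have [g0 g1] := IH (ltnW rn).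
have gn0 : gram_det b n r != 0 by rewrite gt_eqF.
have [d0 d1] := typ r rn gn0.
rewrite gram_detS// mulr_gt0//; split => //.
rewrite !big_ord_recr /= lnM ?posrE//.
rewrite opprD addrACA; apply: le_trans (ler_normD _ _) _.
exact: lerD.
Qed.

Lemma logdet_gramE b n r : (0 < n)%N -> 0 < gram_det b n r ->
  logdet_gram b n r = (ln (gram_det b n r) - r%:R * ln n%:R)%:E.
Proof.
move=> n0 g0; rewrite /logdet_gram detZ.
have n0' : 0 < n%:R^-1 :> R by rewrite invr_gt0 ltr0n.
rewrite -/(gram _) -/(gram_det b n r) lne_EFin ?mulr_gt0 ?exprn_gt0//.
rewrite lnM ?posrE ?exprn_gt0// lnXn// lnV ?posrE ?ltr0n//.
by rewrite mulNrn mulr_natl addrC.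
Qed.

Lemma rate_JE (t : R) : t <= 1 -> rate_J (1 - t) = (entropy (1 - t) + 1)%:E.
Proof.
move=> t1; rewrite /rate_J /entropy; case: ltP => // u0.
have -> : 1 - t = 0 by lra.
by rewrite eqxx mul0r subrr add0r.
Qed.

Lemma entropy_div (q n : nat) : (0 < n)%N ->
  entropy (q%:R / n%:R : R) = (entropy q%:R - q%:R * ln n%:R) / n%:R.
Proof.
move=> n0; rewrite /entropy; have [->|q0] := posnP q.
  by rewrite !mul0r !subr0 mul0r.
rewrite ln_div ?posrE ?ltr0n//; field.
by rewrite pnatr_eq0 -lt0n.
Qed.

(** Constant in front of (1 + log n)^2 / n in the error of a typical array. *)
Definition error_const (eps : R) : R := 36 / cramer eps + 3.

Lemma typical_logdet_close b n eps (t : R) :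
  0 < eps -> (0 < n)%N -> typical b n eps -> 0 <= t <= 1 ->
  (`| (n%:R^-1)%:E * logdet_gram b n (Num.truncn (n%:R * t)) + rate_J (1 - t) | <=
   (eps + error_const eps * (1 + ln n%:R) ^+ 2 / n%:R)%:E)%E.
Proof.
move=> e0 n0 typ /andP[t0 t1]; set r := Num.truncn _.
have n0' : 0 < n%:R :> R by rewrite ltr0n.
have /andP[rle rlt] : r%:R <= n%:R * t < r.+1%:R.
  by apply: truncn_itv; rewrite mulr_ge0// ltW.
have rn : (r <= n)%N.
  by rewrite -(ler_nat R); apply: le_trans rle _; rewrite ler_piMr// ltW.
have [g0 g1] := typical_ln_gram_det typ rn.
rewrite logdet_gramE// rate_JE// -EFinM -EFinD /= lee_fin.
have g2 := @sum_ln_entropy_le R n r n0 rn.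
have g3 := sum_tolerance_le e0 n0 rn.
set L : R := ln n%:R; have L0 : 0 <= L by rewrite ln_ge0// ler1n.
set q := (n - r)%N; have qr : q%:R = n%:R - r%:R :> R by rewrite natrB.
have vE := @entropy_div q n n0; rewrite -/L in vE.
have inv1 : n%:R^-1 * n%:R = 1 :> R by rewrite mulVf// gt_eqF.
have tE : t = n%:R^-1 * (n%:R * t) by rewrite mulrA inv1 mul1r.
have ni0 : 0 < n%:R^-1 :> R by rewrite invr_gt0.
have vr : q%:R / n%:R = 1 - n%:R^-1 * r%:R :> R by rewrite qr; field; rewrite gt_eqF.
have g4 : `|entropy (q%:R / n%:R) - entropy (1 - t)| <= (2 + L) / n%:R.
  apply: entropy_modulus => //.
  - by rewrite subr_ge0.
  - by rewrite vr tE lerD2l lerN2 ler_pM2l.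
  - have : n%:R^-1 * (n%:R * t) <= n%:R^-1 * (r%:R + 1).
      by rewrite ler_pM2l// ltW// natr1.
    rewrite -tE vr; lra.
  - by rewrite vr gerBl mulr_ge0// ltW.
  - have [->|q0] := posnP q; first by left; rewrite mul0r.
    by right; rewrite ler_peMl ?ler1n// ltW.
  - move=> u0; have t1' : t = 1 by lra.
    have : (n <= r)%N by rewrite /r t1' mulr1 natrK.
    by rewrite -subn_eq0 -/q => /eqP ->; rewrite mul0r.
move: g1 g2 g3 g4; rewrite -/L -/q.
set lg := ln (gram_det _ _ _); set S := \sum_(k < r) ln _; set tau := \sum_(k < r) _.
move=> g1 g2 g3 g4.
have -> : n%:R^-1 * (lg - r%:R * L) + (entropy (1 - t) + 1) =
  n%:R^-1 * (lg - S) + n%:R^-1 * (S - (entropy n%:R - entropy q%:R))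
  - (entropy (q%:R / n%:R) - entropy (1 - t)).
  rewrite vE; have -> : entropy n%:R = n%:R * L - n%:R by [].
  rewrite qr; field.
  by rewrite gt_eqF.
apply: le_trans (ler_normB _ _) _.
have h1 : `|n%:R^-1 * (lg - S) + n%:R^-1 * (S - (entropy n%:R - entropy q%:R))| <=
   n%:R^-1 * (n%:R * eps + 6 * L / cramer eps * (1 + 6 * L)) + n%:R^-1 * (1 + L).
  apply: le_trans (ler_normD _ _) _; rewrite !normrM (gtr0_norm ni0).
  by apply: lerD; rewrite ler_pM2l//; exact: le_trans g3.
apply: le_trans (lerD h1 g4) _.
have c0 := cramer_gt0 e0; have ci0 : 0 < (cramer eps)^-1 by rewrite invr_gt0.
have -> : n%:R^-1 * (n%:R * eps + 6 * L / cramer eps * (1 + 6 * L)) +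
    n%:R^-1 * (1 + L) + (2 + L) / n%:R =
    eps + ((cramer eps)^-1 * (6 * L * (1 + 6 * L)) + (3 + 2 * L)) / n%:R.
  by field; rewrite !gt_eqF.
rewrite lerD2l ler_pM2r// /error_const.
have k1 : 6 * L * (1 + 6 * L) <= 36 * (1 + L) ^+ 2 by nra.
have k2 : (cramer eps)^-1 * (6 * L * (1 + 6 * L)) <= (cramer eps)^-1 * (36 * (1 + L) ^+ 2).
  by rewrite ler_pM2l.
have -> : (36 / cramer eps + 3) * (1 + L) ^+ 2 =
    (cramer eps)^-1 * (36 * (1 + L) ^+ 2) + 3 * (1 + L) ^+ 2 by ring.
by apply: lerD => //; nra.
Qed.

End Deterministic.

(** * Almost every sequence of arrays is eventually typical *)

Section BorelCantelli.
Context {R : realType} {d : measure_display} {T : measurableType d}.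
Context {P : probability T R} (b : nat -> nat -> {RV P >-> R}).
Hypothesis b_normal : forall i j, standard_normal (b i j).
Hypothesis b_indep : mutually_independent (fun ij : nat * nat => b ij.1 ij.2).

Local Notation array w := (fun i j => b i j w).

(** Column [r] is out of tolerance, on either side. *)
Definition atypical_column eps n r : set T :=
  deviation_set b n r (tolerance eps n (n - r)) `|`
  deviation_set b n r (- tolerance eps n (n - r)).

(** Some column of the [n]-row array is out of tolerance. *)
Definition atypical eps n : set T :=
  \big[setU/set0]_(r < n) atypical_column eps n r.

Lemma measurable_atypical_column eps n r : measurable (atypical_column eps n r).
Proof. by apply: measurableU; exact: measurable_deviation_set. Qed.

Lemma measurable_atypical eps n : measurable (atypical eps n).
Proof.
by apply: bigsetU_measurable => r _; exact: measurable_atypical_column.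
Qed.

Lemma not_atypical eps n w : 0 < eps -> ~ atypical eps n w ->
  typical (array w) n eps.
Proof.
move=> e0 nat_w r rn gr.
have n0 : (0 < n)%N by exact: leq_ltn_trans rn.
have {}nat_w : ~ atypical_column eps n r w.
  apply: contra_not nat_w => Hr; rewrite /atypical -bigcup_mkord.
  by exists r.
set t := tolerance eps n (n - r) in nat_w *.
have t0 : 0 < t by exact: tolerance_gt0.
set Y := dist2 (array w) n r; set m : R := (n - r)%:R.
have m0 : 0 < m by rewrite ltr0n subn_gt0.
have lower : m * expR (- t) < Y.
  rewrite ltNge; apply/negP => H; apply: nat_w; left; rewrite /deviation_set /=.
  by rewrite gr ler_pM2l// divr_gt0// subr_gt0 -expR0 ltr_expR.
have upper : Y < m * expR t.
  rewrite ltNge; apply/negP => H; apply: nat_w; right; rewrite /deviation_set /=.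
  by rewrite gr opprK ler_nM2l// pmulr_llt0// subr_lt0 -[ltRHS]expR0 ltr_expR oppr_lt0.
have Y0 : 0 < Y by apply: lt_trans lower; rewrite mulr_gt0 ?expR_gt0.
split=> //.
have lnE s : ln (m * expR s) = ln m + s by rewrite lnM ?posrE ?expR_gt0// expRK.
have : ln (m * expR (- t)) <= ln Y by rewrite ler_ln ?posrE ?mulr_gt0 ?expR_gt0 ?ltW.
have : ln Y <= ln (m * expR t) by rewrite ler_ln ?posrE ?mulr_gt0 ?expR_gt0 ?ltW.
by rewrite !lnE ler_norml => H1 H2; apply/andP; split; lra.
Qed.

Lemma atypical_column_le eps n r : 0 < eps -> (r < n)%N ->
  (P (atypical_column eps n r) <= (2 / n%:R ^+ 3)%:E)%E.
Proof.
move=> e0 rn; have n0 : (0 < n)%N by exact: leq_ltn_trans rn.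
have m0 : (0 < n - r)%N by rewrite subn_gt0.
have cube : expR (- (3 * ln n%:R)) = (n%:R ^+ 3)^-1 :> R.
  by rewrite expRN expRM_natl lnK// posrE ltr0n.
have := @tolerance_cramer R eps n (n - r) m0 n0.
rewrite /atypical_column; set t := tolerance _ _ _; set m : R := (n - r)%:R.
have mpos : 0 < m by rewrite ltr0n.
move=> Hc; have : cramer t <= cramer_lower t by rewrite ge_min lexx.
rewrite -(ler_pM2l mpos) => /(le_trans Hc); rewrite /cramer_lower => H1.
have : cramer t <= cramer_upper t by rewrite ge_min lexx orbT.
rewrite -(ler_pM2l mpos) => /(le_trans Hc); rewrite /cramer_upper => H2.
have -> : 2 / n%:R ^+ 3 = (n%:R ^+ 3)^-1 + (n%:R ^+ 3)^-1 :> R by ring.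
apply: le_trans (measureU2 _ _ _) _; [exact: measurable_deviation_set..|].
rewrite EFinD -cube; apply: leeD.
- apply: le_trans (deviation_set_le b_normal b_indep _ rn) _.
  rewrite lee_fin ler_expR -/m; lra.
- apply: le_trans (deviation_set_le b_normal b_indep _ rn) _.
  rewrite lee_fin ler_expR -/m opprK; lra.
Qed.

Lemma atypical_le eps n : 0 < eps -> (P (atypical eps n) <= (2 / n%:R ^+ 2)%:E)%E.
Proof.
move=> e0; apply: le_trans (Boole_inequality _ _) _.
  by move=> r _; exact: measurable_atypical_column.
apply: (@le_trans _ _ (\sum_(r < n) (2 / n%:R ^+ 3)%:E)%E).
  by apply: lee_sum => r _; exact: atypical_column_le.
rewrite sumEFin lee_fin sumr_const card_ord.
have [->|n0] := posnP n; first by rewrite mulr0n divr_ge0// sqr_ge0.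
rewrite -mulr_natl le_eqVlt; apply/orP; left; apply/eqP; field.
by rewrite pnatr_eq0 -lt0n.
Qed.

(** The bound 2/n^2 is compared with the telescoping 4/n - 4/(n+1). *)
Lemma sum_atypical_le eps N : 0 < eps ->
  (\sum_(0 <= n < N.+1) P (atypical eps n) <= (4 * (1 - N.+1%:R^-1))%:E)%E.
Proof.
move=> e0; elim: N => [|N IH].
  by rewrite big_nat1 /atypical big_ord0 measure0 invr1 subrr mulr0.
rewrite big_nat_recr//=; apply: le_trans (leeD IH (atypical_le _ e0)) _.
rewrite -EFinD lee_fin; set x : R := N.+1%:R.
have x1 : 1 <= x by rewrite ler1n.
have -> : N.+2%:R = x + 1 :> R by rewrite /x natr1.
have x0 : x != 0 by rewrite gt_eqF//; lra.
have x10 : x + 1 != 0 by rewrite gt_eqF//; lra.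
have -> : 4 * (1 - x^-1) + 2 / x ^+ 2 = 4 * (1 - (x + 1)^-1) -
    (2 * x - 2) / (x ^+ 2 * (x + 1)).
  by clearbody x; field; rewrite x10 x0.
rewrite gerBl divr_ge0 ?mulr_ge0 ?sqr_ge0//; lra.
Qed.

Lemma lim_sup_atypical0 eps : 0 < eps -> P (lim_sup_set (atypical eps)) = 0%E.
Proof.
move=> e0; apply: lim_sup_set_cvg0; first by move=> n; exact: measurable_atypical.
apply: (@le_lt_trans _ _ 4%:E); last exact: ltry.
apply: lime_le; first by apply: is_cvg_nneseries => n _ _; exact: measure_ge0.
exists 1%N => // -[//|N] _.
apply: le_trans (sum_atypical_le _ e0) _; rewrite lee_fin.
by rewrite ler_piMr// gerBl.
Qed.

Lemma ae_eventually_typical eps : 0 < eps ->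
  {ae P, forall w, \forall n \near \oo, typical (array w) n eps}.
Proof.
move=> e0; exists (lim_sup_set (atypical eps)); split.
- apply: bigcapT_measurable => n; apply: bigcup_measurable => k _.
  exact: measurable_atypical.
- exact: lim_sup_atypical0.
move=> w /= Hw N _; apply: contrapT => HN; apply: Hw.
exists N => // n /= Nn; apply: not_atypical => // wn; apply: HN.
by exists n.
Qed.

End BorelCantelli.

(** * Uniform convergence *)

Section Conclusion.
Context {R : realType}.
Implicit Types b : nat -> nat -> R.

(** Distance at time [t] between the normalized log-determinant and its limit. *)
Definition profile_error b n (t : R) : \bar R :=
  `| (n%:R^-1)%:E * logdet_gram b n (Num.truncn (n%:R * t)) + rate_J (1 - t) |%E.

Definition sup_error b n : \bar R :=
  ereal_sup [set profile_error b n t | t in `[0, 1]%classic].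

Lemma sup_error_ge0 b n : (0 <= sup_error b n)%E.
Proof.
rewrite /sup_error; apply: le_ereal_sup_tmp.
exists (profile_error b n 0); last exact: abse_ge0.
by exists 0; rewrite //= in_itv /= lexx ler01.
Qed.

(** It suffices that the arrays be eventually typical for the tolerances
    1/(k+1). *)
Lemma sup_error_cvg0 b :
  (forall k, \forall n \near \oo, typical b n k.+1%:R^-1) ->
  sup_error b n @[n --> \oo] --> 0%E.
Proof.
move=> typ.
have small e : 0 < e -> \forall n \near \oo, (0 <= sup_error b n <= e%:E)%E.
  move=> e0; pose k := Num.truncn (2 / e); set eps : R := k.+1%:R^-1.
  have eps0 : 0 < eps by rewrite invr_gt0.
  have eps_le : eps <= e / 2.
    rewrite /eps -[leRHS]invf_div lef_pV2 ?posrE ?divr_gt0//.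
    by apply: ltW; exact: truncnS_gt.
  have K0 : 0 <= error_const eps.
    by rewrite /error_const addr_ge0// divr_ge0// ltW// cramer_gt0.
  have sq := @log_square_small R (error_const eps) (e / 2) K0 _.
  near=> n; rewrite sup_error_ge0 /=.
  apply: ge_ereal_sup => _ [t /= t01 <-].
  have n0 : (0 < n)%N by near: n; exists 1%N.
  apply: le_trans (typical_logdet_close (eps := eps) eps0 n0 _ _) _.
  - by near: n; exact: typ.
  - by move: t01; rewrite in_itv.
  rewrite lee_fin; have : error_const eps * (1 + ln n%:R) ^+ 2 / n%:R <= e / 2.
    by near: n; apply: sq; rewrite divr_gt0.
  lra.
move=> A /= [e /= e0 eA].
have e20 : 0 < e / 2 by rewrite divr_gt0.
apply: filterS (small _ e20) => n /andP[h0 h1]; rewrite /preimage /=.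
move: h0 h1; case: (sup_error b n) => [s| |] //; rewrite !lee_fin => h0 h1.
apply: eA; rewrite /ball_ /= sub0r normrN ger0_norm//; lra.
Unshelve. all: by end_near.
Qed.

End Conclusion.

Theorem theorem5p2 (R : realType) (d : measure_display) (T : measurableType d)
    (P : probability T R) (b : nat -> nat -> {RV P >-> R})
    (b_normal : forall i j : nat, standard_normal (b i j))
    (b_indep : mutually_independent (fun ij : nat * nat => b ij.1 ij.2)) :
  {ae P, forall w : T,
    ereal_sup
      [set `| (n%:R^-1)%:E
                * logdet_gram (fun i j => b i j w) n (Num.truncn (n%:R * t))
              + rate_J (1 - t) |%E | t in `[0, 1]%classic]
      @[n --> \oo] --> 0%E}.
Proof.
have : {ae P, forall w, forall k, \forall n \near \oo,
    typical (fun i j => b i j w) n k.+1%:R^-1}.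
  by apply: ae_foralln => k; apply: ae_eventually_typical.
by apply: filterS => w; exact: sup_error_cvg0.
Qed.
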